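(* Let $G=(V,E)$ be a finite connected graph with $N=\operatorname{card}(V)$ vertices and chromatic number $\chi=\chi(G)$, and let $0\le\epsilon<1$. Then \[ \epsilon<(\chi-1)^{-1}\ \Longrightarrow\ \mu_\epsilon(G)=\operatorname{card}(V)=N, \] \[ \epsilon\ge(\chi-1)^{-1}\ \Longrightarrow\ \mu_\epsilon(G)\ \ge\ \max\bigl(\lceil N/\chi\rceil+1,\ \lceil\epsilon^{-1}\rceil\bigr). \]
   Context: Graphs are simple and undirected. For a finite graph $G=(V,E)$ and a confidence threshold $\epsilon\in[0,1]$, an absorbing state (static configuration) is a map $\eta:V\to[0,1]$ such that for each edge $(x,y)\in E$ one has $|\eta(x)-\eta(y)|>\epsilon$ or $\eta(x)=\eta(y)$. The $\epsilon$-opinion index $\mu_\epsilon(G)$ is the maximum, over all absorbing states $\eta$, of the number of distinct opinions $\operatorname{card}\{\eta(x):x\in V\}$. The chromatic number $\chi(G)$ is the smallest number of colors needed to color the vertices so that no two adjacent vertices receive the same color. $\lceil a\rceil$ denotes the least integer not less than $a$. Convention: $(\chi-1)^{-1}=+\infty$ when $\chi=1$ (i.e. $N=1$). *)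

(* Defs.v *)
From HB Require Import structures.
From mathcomp Require Import all_boot all_order all_algebra.
From mathcomp Require Import boolp constructive_ereal reals.

Set Implicit Arguments.
Unset Strict Implicit.
Unset Printing Implicit Defensive.
Import Order.TTheory GRing.Theory Num.Theory.
Local Open Scope ring_scope.

Record sgraph := SGraph {
  vertex :> finType;
  edge : rel vertex;
  edge_sym : symmetric edge;
  edge_irr : irreflexive edge }.

(* The empty graph is not connected. *)
Definition connected_graph (G : sgraph) : Prop :=
  (0 < #|G|)%N /\ forall x y : G, connect (@edge G) x y.

Section Chromatic.
Variable G : sgraph.

Definition proper_coloring (k : nat) (c : {ffun G -> 'I_k}) : bool :=
  [forall x, forall y, edge x y ==> (c x != c y)].

Definition colorable (k : nat) : bool :=
  [exists c : {ffun G -> 'I_k}, proper_coloring c].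

Lemma colorable_ex : exists k, colorable k.
Proof.
exists #|G|; apply/existsP; exists [ffun x => enum_rank x].
apply/forallP => x; apply/forallP => y; apply/implyP => exy.
rewrite !ffunE (inj_eq enum_rank_inj).
by apply/eqP => eq_xy; rewrite eq_xy edge_irr in exy.
Qed.

Definition chromatic_number : nat := ex_minn colorable_ex.

End Chromatic.

Section OpinionIndex.
Variables (R : realType) (eps : R) (G : sgraph).

Definition absorbing (eta : G -> R) : Prop :=
  (forall x, 0 <= eta x <= 1) /\
  (forall x y, edge x y -> eps < `|eta x - eta y| \/ eta x = eta y).

Definition num_opinions (eta : G -> R) : nat := size (undup (codom eta)).

Definition attained (k : nat) : bool :=
  `[< exists eta : G -> R, absorbing eta /\ num_opinions eta = k >].

Lemma attained_ex : exists k, attained k.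
Proof.
exists (num_opinions (fun=> 0)); apply/asboolP; exists (fun=> 0).
by split=> //; split=> [x|x y _]; [rewrite lexx ler01 | right].
Qed.

Lemma attained_le k : attained k -> (k <= #|G|)%N.
Proof.
move=> /asboolP[eta [_ <-]].
by rewrite (leq_trans (size_undup _))// size_codom.
Qed.

Definition opinion_index : nat := ex_maxn attained_ex attained_le.

End OpinionIndex.

(* (chi - 1)^-1 as an extended real: the inverse of 0 in \bar R is +oo,
   which is the convention in force when chi = 1. *)
Definition threshold (R : realType) (G : sgraph) : \bar R :=
  inve ((chromatic_number G)%:R - 1)%:E.
Arguments threshold R G : clear implicits.

Lemma threshold_chi1 (R : realType) (G : sgraph) :
  chromatic_number G = 1%N -> threshold R G = +oo%E.
Proof. by rewrite /threshold => ->; rewrite subrr inve0. Qed.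

(* Main.v *)
Require Import Defs.
From HB Require Import structures.
From mathcomp Require Import all_boot all_order all_algebra.
From mathcomp Require Import boolp constructive_ereal reals.
From mathcomp Require Import ring lra.

Set Implicit Arguments.
Unset Strict Implicit.
Unset Printing Implicit Defensive.
Import Order.TTheory GRing.Theory Num.Theory.
Local Open Scope ring_scope.

(** The opinion index is a maximum, trivially at most the number of vertices, so
    it suffices to exhibit absorbing states with enough opinions; each one is
    read off an optimal proper coloring [c].

    Below the threshold, the [chi] levels [i * a] with [a] slightly larger than
    [eps] fit in [[0, 1]] with room to spare. Putting the vertex [x] at height
    [c x * a] and moving it up by its own tiny offset makes all opinions
    distinct while neighbors, having distinct colors, stay more than [eps]
    apart.

    Above the threshold the levels no longer fit, but two coarser states do.
    By pigeonhole some color class has at least [N / chi] vertices; it is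
    independent, so its vertices may take distinct opinions in the interval
    from [eps] to [1] while all the others share the opinion [0]. For the other
    bound put [K := ceil eps^-1]: then [K - 1] steps longer than [eps] fit in
    [[0, 1]], and merging all colors from [K - 1] on into the top level gives
    [K] levels. They are all inhabited because [K < chi] and a coloring with
    [chi] colors uses every color. *)

(** * Optimal colorings *)

Lemma proper_coloringP {G : sgraph} {k : nat} (c : {ffun G -> 'I_k}) :
  reflect (forall x y, edge x y -> c x != c y) (proper_coloring c).
Proof.
apply: (iffP forallP) => [h x y|h x]; first exact/implyP/(forallP (h x)).
by apply/forallP => y; apply/implyP/h.
Qed.

Lemma chromatic_coloring (G : sgraph) :
  exists c : {ffun G -> 'I_(chromatic_number G)}, proper_coloring c.
Proof. by rewrite /chromatic_number; case: ex_minnP => k /existsP. Qed.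

Lemma chromatic_number_le (G : sgraph) (k : nat) (c : {ffun G -> 'I_k}) :
  proper_coloring c -> (chromatic_number G <= k)%N.
Proof.
move=> cP; rewrite /chromatic_number; case: ex_minnP => m _; apply.
by apply/existsP; exists c.
Qed.

Lemma chromatic_number_gt0 (G : sgraph) :
  (0 < #|G|)%N -> (0 < chromatic_number G)%N.
Proof.
move=> /card_gt0P[x _]; have [c _] := chromatic_coloring G.
exact: leq_ltn_trans (ltn_ord (c x)).
Qed.

(** An unused color could be removed, leaving a proper coloring with fewer
    colors than the chromatic number. *)
Lemma chromatic_coloring_surj (G : sgraph)
    (c : {ffun G -> 'I_(chromatic_number G)}) (i : 'I_(chromatic_number G)) :
  proper_coloring c -> exists x, c x = i.
Proof.
move: c i; case chiE: (chromatic_number G) => [|k] c i; first by case: i.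
move=> /proper_coloringP cP.
suff /existsP[x /eqP] : [exists x, c x == i] by exists x.
apply: contraT; rewrite negb_exists => /forallP unused.
have i_neq x : i != c x by rewrite eq_sym.
pose c' : {ffun G -> 'I_k} := [ffun x => s2val (unlift_some (i_neq x))].
have c'E x : c x = lift i (c' x).
  by rewrite ffunE; exact: (s2valP (unlift_some (i_neq x))).
have c'P : proper_coloring c'.
  apply/proper_coloringP => x y /cP; rewrite !c'E.
  by apply: contra => /eqP ->.
by have := chromatic_number_le c'P; rewrite chiE ltnn.
Qed.

Lemma large_color_class (T : finType) (k : nat) (c : T -> 'I_k) :
  (0 < k)%N -> exists i, (#|T| <= k * #|[pred x | c x == i]|)%N.
Proof.
case: k c => // k c _.
pose i := [arg max_(i > (ord0 : 'I_k.+1)) #|[pred x | c x == i]|].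
exists i; rewrite -sum1_card (partition_big c predT)//=.
rewrite -[X in (_ <= X * _)%N]card_ord -sum_nat_const; apply: leq_sum => j _.
rewrite sum1_card /i; case: arg_maxnP => // m _; exact.
Qed.

(** * Counting opinions *)

Section Opinions.
Variables (R : realType) (G : sgraph).
Implicit Types (eps a : R) (eta : G -> R).

Lemma num_opinions_le eps eta :
  absorbing eps eta -> (num_opinions eta <= opinion_index eps G)%N.
Proof.
move=> etaP; rewrite /opinion_index; case: ex_maxnP => k _; apply.
by apply/asboolP; exists eta.
Qed.

Lemma opinion_index_le eps : (opinion_index eps G <= #|G|)%N.
Proof.
by rewrite /opinion_index; case: ex_maxnP => k kP _; exact: attained_le kP.
Qed.

Lemma size_le_num_opinions eta (s : seq R) :
  uniq s -> {subset s <= codom eta} -> (size s <= num_opinions eta)%N.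
Proof.
by move=> s_uniq sP; apply: uniq_leq_size => // r /sP; rewrite mem_undup.
Qed.

Lemma card_le_num_opinions eta (A : pred G) :
  {in A &, injective eta} -> (#|A| <= num_opinions eta)%N.
Proof.
move=> eta_inj; rewrite cardE -(size_map eta); apply: size_le_num_opinions.
  rewrite map_inj_in_uniq ?enum_uniq// => x y.
  by rewrite !mem_enum; exact: eta_inj.
by move=> _ /mapP[x _ ->]; exact: codom_f.
Qed.

(** * Building blocks of absorbing states *)

Definition offset (x : G) : R := (enum_rank x)%:R / #|G|%:R.

Lemma offset_ge0 x : 0 <= offset x.
Proof. exact: divr_ge0. Qed.

Lemma offset_lt1 x : offset x < 1.
Proof.
have N0 : (0 < #|G|)%N by apply/card_gt0P; exists x.
by rewrite /offset ltr_pdivrMr ?ltr0n// mul1r ltr_nat.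
Qed.

Lemma offset_inj : injective offset.
Proof.
move=> x y; have N0 : (0 < #|G|)%N by apply/card_gt0P; exists x.
have Nneq0 : (#|G|%:R : R)^-1 != 0 by rewrite invr_eq0 pnatr_eq0 -lt0n.
move=> /(mulIf Nneq0)/eqP; rewrite eqr_nat => /eqP/val_inj.
exact: enum_rank_inj.
Qed.

Lemma level_dist a (i j : nat) :
  0 <= a -> i != j -> a <= `|i%:R * a - j%:R * a|.
Proof.
move=> a0 ij; rewrite -mulrBl normrM (ger0_norm a0) ler_peMl//.
wlog lt_ij : i j ij / (i < j)%N.
  move=> wlg; move: (ij); rewrite neq_ltn => /orP[/wlg->//|/wlg].
  by rewrite distrC; apply; rewrite eq_sym.
by rewrite distrC -natrB ?(ltnW lt_ij)// normr_nat ler1n subn_gt0.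
Qed.

(** * Lower bounds on the opinion index *)

Lemma opinion_index_full eps (k : nat) (c : {ffun G -> 'I_k.+1}) :
  proper_coloring c -> 0 <= eps -> k%:R * eps < 1 ->
  opinion_index eps G = #|G|.
Proof.
move=> /proper_coloringP cP eps0 keps.
(* [d] is the slack left by [k] steps of length [eps], shared equally between
   these steps and the range of the offsets. *)
pose d : R := (1 - k%:R * eps) / k.+1%:R.
have d0 : 0 < d by rewrite divr_gt0 ?ltr0n// subr_gt0.
have dE : k%:R * (eps + d) + d = 1.
  have -> : k%:R * (eps + d) + d = k%:R * eps + d * k.+1%:R.
    by rewrite -addn1 natrD; ring.
  by rewrite divfK ?pnatr_eq0//; ring.
pose eta (x : G) : R := (c x)%:R * (eps + d) + d * offset x.
have off x : 0 <= d * offset x < d.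
  by rewrite mulr_ge0 ?offset_ge0 ?ltW//= gtr_pMr// offset_lt1.
have eta_far x y : c x != c y -> eps < `|eta x - eta y|.
  move=> cxy; have ad0 : 0 <= eps + d by rewrite addr_ge0// ltW.
  have := level_dist ad0 cxy; have := off x; have := off y.
  rewrite /eta; move: (_ * offset _) (_ * offset _) => u v.
  move: (_ * _) (_ * _) => p q uP vP.
  rewrite ler_normr ltr_normr => /orP[h|h]; apply/orP; [left|right]; lra.
have eta_absorbing : absorbing eps eta.
  split=> [x|x y /cP/eta_far]; last by left.
  have := off x; have : (c x)%:R * (eps + d) <= k%:R * (eps + d).
    by rewrite ler_wpM2r ?addr_ge0 ?(ltW d0)// ler_nat -ltnS.
  have : 0 <= (c x)%:R * (eps + d) by rewrite mulr_ge0// addr_ge0// ltW.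
  rewrite /eta; move: (_ * offset _) ((c x)%:R * _) dE.
  move: (k%:R * _) => u v w; lra.
have eta_inj : injective eta.
  move=> x y exy; have [cxy|/eta_far] := eqVneq (c x) (c y).
    move: exy; rewrite /eta cxy => /addrI.
    by move=> /(mulfI (lt0r_neq0 d0))/offset_inj.
  by rewrite exy subrr normr0 ltNge eps0.
apply/eqP; rewrite eqn_leq opinion_index_le/=.
apply: leq_trans (num_opinions_le eta_absorbing).
by apply: (card_le_num_opinions (A := predT)) => x y _ _; exact: eta_inj.
Qed.

(** An independent set can take pairwise distinct opinions above [eps] when
    every other vertex has the opinion [0]. *)
Lemma opinion_index_independent eps (A : pred G) (z : G) :
  0 <= eps < 1 -> (forall x y, A x -> A y -> ~~ edge x y) -> ~~ A z ->
  (#|A| < opinion_index eps G)%N.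
Proof.
move=> /andP[eps0 eps1] indep Az.
pose eta (x : G) : R := if A x then 1 - (1 - eps) * offset x else 0.
have eps'0 : 0 < 1 - eps by rewrite subr_gt0.
have etaA x : A x -> eps < eta x <= 1.
  move=> Ax; rewrite /eta Ax gerBl mulr_ge0 ?offset_ge0 ?(ltW eps'0)//.
  have : (1 - eps) * offset x < 1 - eps by rewrite gtr_pMr// offset_lt1.
  by move: (_ * _) => u; lra.
have etaNA x : ~~ A x -> eta x = 0 by rewrite /eta => /negbTE->.
have eta_absorbing : absorbing eps eta.
  split=> [x|x y exy].
    have [/etaA|/etaNA->] := boolP (A x); last by rewrite lexx ler01.
    by move: (eta x) => u; lra.
  have [Ax|/etaNA->] := boolP (A x); have [Ay|/etaNA->] := boolP (A y).
  - by have := indep x y Ax Ay; rewrite exy.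
  - left; rewrite subr0; have /andP[h _] := etaA _ Ax.
    by rewrite ltr_normr h.
  - left; rewrite sub0r normrN; have /andP[h _] := etaA _ Ay.
    by rewrite ltr_normr h.
  - by right.
apply: leq_trans (num_opinions_le eta_absorbing).
have -> : #|A|.+1 = #|[predU1 z & A]| by rewrite cardU1 unfold_in/= Az.
apply: card_le_num_opinions.
have zA y : A y -> eta z <> eta y.
  by move=> /etaA/andP[h _] e; move: h; rewrite -e etaNA// ltNge eps0.
move=> x y; rewrite !inE => /predU1P[->|Ax] /predU1P[->|Ay] //.
- by move=> /zA; case.
- by move=> e; case: (zA x).
rewrite /eta [A x]Ax [A y]Ay => /addrI/oppr_inj.
by move=> /(mulfI (lt0r_neq0 eps'0))/offset_inj.
Qed.

(** Sending all colors from [k] on to the same level keeps neighbors either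
    equal or at least one step apart, and with only [chi] colors every level is
    reached. *)
Lemma opinion_index_levels eps (k : nat) :
  (0 < k < chromatic_number G)%N -> k%:R * eps < 1 ->
  (k < opinion_index eps G)%N.
Proof.
move=> /andP[k0 k_chi] keps; have [c cP] := chromatic_coloring G.
have kR0 : 0 < k%:R :> R by rewrite ltr0n.
have eps_step : eps < k%:R^-1 by rewrite -[ltRHS]mul1r ltr_pdivlMr// mulrC.
pose eta (x : G) : R := (minn (c x) k)%:R * k%:R^-1.
have eta_absorbing : absorbing eps eta.
  split=> [x|x y _].
    by rewrite divr_ge0//= ler_pdivrMr// mul1r ler_nat geq_minr.
  rewrite /eta; have [->|/level_dist h] := eqVneq (minn (c x) k) (minn (c y) k).
    by right.
  by left; apply: lt_le_trans eps_step _; apply: h; rewrite invr_ge0 ltW.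
apply: leq_trans (num_opinions_le eta_absorbing).
pose levels : seq R := [seq i%:R * k%:R^-1 | i <- iota 0 k.+1].
have -> : k.+1 = size levels by rewrite size_map size_iota.
apply: size_le_num_opinions.
  rewrite map_inj_uniq ?iota_uniq// => i j /mulIf h.
  by apply/eqP; rewrite -(eqr_nat R); apply/eqP/h; rewrite invr_eq0 gt_eqF.
move=> _ /mapP[i + ->]; rewrite mem_iota/= add0n ltnS => ik.
have i_chi : (i < chromatic_number G)%N := leq_ltn_trans ik k_chi.
have [x cx] := chromatic_coloring_surj (Ordinal i_chi) cP.
by apply/codomP; exists x; rewrite /eta cx/= (minn_idPl ik).
Qed.

(** The product form of the condition also covers [k = 0], where the threshold
    is infinite. *)
Lemma lt_threshold eps (k : nat) :
  chromatic_number G = k.+1 ->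
  (eps%:E < threshold R G)%E = (k%:R * eps < 1).
Proof.
rewrite /threshold => ->; rewrite -addn1 natrD addrK.
case: k => [|k]; first by rewrite inve0 ltry mul0r ltr01.
by rewrite inver pnatr_eq0/= lte_fin -[ltRHS]mul1r ltr_pdivlMr ?ltr0n// mulrC.
Qed.

End Opinions.

(** * The two regimes *)

Theorem theorem1p1 (R : realType) (G : sgraph) (eps : R)
    (Gconn : connected_graph G) (eps_ge0 : 0 <= eps) (eps_lt1 : eps < 1) :
  ((eps%:E < threshold R G)%E -> opinion_index eps G = #|G|) /\
  ((threshold R G <= eps%:E)%E ->
    Num.max (Num.ceil (#|G|%:R / (chromatic_number G)%:R : R) + 1)
            (Num.ceil eps^-1)
      <= (opinion_index eps G)%:Z).
Proof.
have [N0 _] := Gconn; have := chromatic_number_gt0 N0.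
case chiE: (chromatic_number G) => [//|k] _.
rewrite leNgt (lt_threshold eps chiE) -leNgt.
have [c cP] := chromatic_coloring G.
split=> [|keps].
  by move: c cP; rewrite chiE => c cP; exact: opinion_index_full cP eps_ge0.
have eps0 : 0 < eps.
  rewrite lt0r eps_ge0 andbT; apply: contraTneq keps => ->.
  by rewrite mulr0 ler10.
have k0 : (0 < k)%N.
  by rewrite lt0n; apply: contraTneq keps => ->; rewrite mul0r ler10.
rewrite ge_max; apply/andP; split.
  have [|i iP] := @large_color_class G _ c; first by rewrite chiE.
  (* Some color differs from [i], as there are at least two; it is used by a
     vertex [z] outside of the large class. *)
  have [z cz] : exists z, c z != i.
    have [j ji] : exists j : 'I_(chromatic_number G), j != i.
      move: i {iP}; rewrite chiE => i.
      exists (if i == ord0 then ord_max else ord0).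
      have [->|] := eqVneq i ord0; last by rewrite eq_sym.
      by rewrite -val_eqE/= -lt0n.
    by have [z cz] := chromatic_coloring_surj j cP; exists z; rewrite cz.
  have := @opinion_index_independent R G eps [pred x | c x == i] z.
  rewrite /= eps_ge0 eps_lt1 => /(_ isT) h.
  have {}h : (#|[pred x | c x == i]| < opinion_index eps G)%N.
    apply: h => // x y /eqP cx /eqP cy; apply/negP => /(proper_coloringP _ cP).
    by rewrite cx cy eqxx.
  rewrite lezD1; apply: le_lt_trans (h : _%:Z < _%:Z).
  rewrite ceil_le_int -pmulrn ler_pdivrMr ?ltr0n// -natrM ler_nat mulnC -chiE.
  exact: iP.
have : (1 < Num.ceil eps^-1) by rewrite ceil_gt_int invf_gt1.
have := ceilB1_lt eps^-1.
have : Num.ceil eps^-1 <= k%:Z.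
  by rewrite ceil_le_int -pmulrn -[leLHS]mul1r ler_pdivrMr.
case: (Num.ceil eps^-1) => [[//|m]|//].
rewrite lez_nat ltz_nat => mk m_lt m0.
apply: (opinion_index_levels (G := G)); first by rewrite -ltnS m0 chiE ltnW.
by move: m_lt; rewrite -[ltRHS]mul1r ltr_pdivlMr// intS addrC addKr.
Qed.
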